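(* Let $(X,d,\mu)$ be a finite measure metric space with $X=\operatorname{supp}(\mu)$ whose measure satisfies the $n$-dimensional growth condition for some real $n>0$. Let $K(x,y)$ be a standard singular integral kernel with regularity exponent $\gamma$, $0<\gamma\leq 1$, and let $0<\beta<\min(n,\gamma)$. For $\varepsilon>0$ let $T_\varepsilon$ be the smoothly truncated operator $$T_\varepsilon f(x)=\int_X \eta\!\left(\frac{d(x,y)}{\varepsilon}\right)K(x,y)f(y)\,d\mu(y).$$ The following two statements are equivalent: (a) There is a constant $C$ such that $\|T_\varepsilon 1\|_{\Lambda_\beta}\leq C$ for all $\varepsilon>0$. (b) The operators $T_\varepsilon:\Lambda_\beta\to\Lambda_\beta$ are bounded and there is a constant $C'$ such that $\|T_\varepsilon\|_{\Lambda_\beta\to\Lambda_\beta}\leq C'$ for all $\varepsilon>0$.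
   Context: Setting: $(X,d)$ is a metric space and $\mu$ is a finite Borel measure on $X$ satisfying the $n$-dimensional growth condition: there are $n>0$ and a constant $A>0$ such that $\mu(B_r)\leq A r^n$ for all balls $B_r$ of radius $r$ and all $r>0$. The support of $\mu$ is assumed to be well defined, where $\operatorname{supp}(\mu)$ is the smallest closed set $F$ such that $\mu(E)=0$ for all Borel sets $E\subset F^c$; and it is assumed that $X=\operatorname{supp}(\mu)$. Inhomogeneous Lipschitz-Hölder spaces: for $0<\beta\leq 1$, $\Lambda_\beta$ is the Banach space of all bounded (complex-valued) functions $f$ on $X$ with $\sup_{x\neq y\in X}\frac{|f(x)-f(y)|}{d(x,y)^\beta}<\infty$, with norm $$\|f\|_{\Lambda_\beta}=\sup_{x\in X}|f(x)|+\sup_{x\neq y\in X}\frac{|f(x)-f(y)|}{d(x,y)^\beta}.$$ Singular integral kernels: let $\Omega=(X\times X)\setminus\Delta$, $\Delta=\{(x,y):x=y\}$. A function $K:\Omega\to\mathbb{C}$ is a standard singular integral kernel (with regularity exponent $\gamma$) if there are constants $C_1,C_2$ and a number $\gamma$, $0<\gamma\leq 1$, such that $$|K(x,y)|\leq\frac{C_1}{d(x,y)^n},$$ $$|K(x_1,y)-K(x_2,y)|\leq C_2\frac{d(x_1,x_2)^\gamma}{d(x_1,y)^{n+\gamma}}\quad\text{whenever } 2d(x_1,x_2)\leq d(x_1,y).$$ Cutoff: $\eta$ is a fixed function in $C^1[0,\infty)$ with $0\leq\eta\leq 1$, $\eta(s)=0$ for $0\leq s\leq 1/2$, and $\eta(s)=1$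 for $s\geq 1$. The truncated kernel is $K_\varepsilon(x,y)=\eta(d(x,y)/\varepsilon)K(x,y)$ (equal to $0$ when $d(x,y)\leq\varepsilon/2$, in particular on the diagonal). Here $1$ denotes the constant function equal to $1$ on $X$. *)

(* Defs.v *)
From HB Require Import structures.
From mathcomp Require Import all_boot all_order all_algebra.
From mathcomp Require Import all_classical all_reals all_analysis.
From mathcomp Require Export complex.

Set Implicit Arguments.
Unset Strict Implicit.
Unset Printing Implicit Defensive.

Import Order.TTheory GRing.Theory Num.Theory.
Import numFieldNormedType.Exports.

Local Open Scope classical_set_scope.
Local Open Scope ring_scope.
Local Open Scope complex_scope.

(* The base point is there only because measurableType requires one: it
   excludes the empty space and nothing else. *)
#[short(type="pointedMetricType")]
HB.structure Definition PointedMetric (K : numDomainType) :=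
  { M of Pointed M & Metric K M }.

Definition borel (R : realType) (X : pointedMetricType R) :=
  g_sigma_algebraType (@open X).

Definition growth_condition (R : realType) (X : pointedMetricType R)
    (mu : set (borel X) -> \bar R) (n : R) : Prop :=
  exists2 A : R, 0 < A &
    forall (x : X) (r : R), 0 < r -> (mu (ball x r) <= (A * r `^ n)%:E)%E.

Definition null_outside (R : realType) (X : pointedMetricType R)
    (mu : set (borel X) -> \bar R) (F : set X) : Prop :=
  forall E : set (borel X), measurable E -> E `<=` ~` F -> mu E = 0%E.

Definition is_support (R : realType) (X : pointedMetricType R)
    (mu : set (borel X) -> \bar R) (F : set X) : Prop :=
  [/\ closed F, null_outside mu F &
      forall G : set X, closed G -> null_outside mu G -> F `<=` G].

Definition cmod (R : realType) (z : R[i]) : R := Normc.normc z.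

Section LipschitzHolder.
Variables (R : realType) (X : pointedMetricType R) (b : R).

Definition abs_values (f : X -> R[i]) : set R :=
  [set cmod (f x) | x in [set: X]].

Definition holder_quotients (f : X -> R[i]) : set R :=
  [set t | exists x y : X,
     x <> y /\ t = cmod (f x - f y) / mdist x y `^ b].

Definition Lambda : set (X -> R[i]) :=
  [set f | has_ubound (abs_values f) /\ has_ubound (holder_quotients f)].

(* The real-valued [sup] is a junk value on unbounded sets, so this is the norm
   only on [Lambda]. *)
Definition Lambda_norm (f : X -> R[i]) : R :=
  sup (abs_values f) + sup (holder_quotients f).

Definition Lambda_bounded (T : (X -> R[i]) -> (X -> R[i])) : Prop :=
  [/\ forall f, Lambda f -> Lambda (T f),
      forall (a : R[i]) (f g : X -> R[i]), Lambda f -> Lambda g ->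
        forall x, T (fun y => a * f y + g y) x = a * T f x + T g x &
      exists M : R, forall f, Lambda f ->
        Lambda_norm (T f) <= M * Lambda_norm f].

(* Meaningful for [Lambda_bounded] operators only, as for [Lambda_norm]. *)
Definition Lambda_opnorm (T : (X -> R[i]) -> (X -> R[i])) : R :=
  sup [set Lambda_norm (T f) | f in
         [set f | Lambda f /\ Lambda_norm f <= 1]].

End LipschitzHolder.

(* A kernel is a total function; its values on the diagonal are unconstrained
   and never used. *)
Definition standard_kernel (R : realType) (X : pointedMetricType R)
    (n g : R) (K : X -> X -> R[i]) : Prop :=
  [/\ 0 < g <= 1,
      exists C1 : R, forall x y : X, x <> y ->
        cmod (K x y) <= C1 / mdist x y `^ n &
      exists C2 : R, forall x1 x2 y : X, x1 <> y -> x2 <> y ->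
        2 * mdist x1 x2 <= mdist x1 y ->
        cmod (K x1 y - K x2 y) <=
          C2 * (mdist x1 x2 `^ g / mdist x1 y `^ (n + g))].

Definition measurable_sections (R : realType) (X : pointedMetricType R)
    (K : X -> X -> R[i]) : Prop :=
  forall x : X,
    measurable_fun (~` [set x] : set (borel X))
      (fun y : borel X => complex.Re (K x y)) /\
    measurable_fun (~` [set x] : set (borel X))
      (fun y : borel X => complex.Im (K x y)).

(* C^1 on the closed half-line, with the one-sided derivative at 0. *)
Definition C1_halfline (R : realType) (h : R -> R) : Prop :=
  exists h' : R -> R,
    {within `[0, +oo[, continuous h'} /\
    forall s : R, 0 <= s ->
      (h t - h s) / (t - s) @[t --> within [set t | 0 <= t] s^'] --> h' s.

Definition cutoff (R : realType) (eta : R -> R) : Prop :=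
  [/\ C1_halfline eta,
      forall s : R, 0 <= s -> 0 <= eta s <= 1,
      forall s : R, 0 <= s <= 2^-1 -> eta s = 0 &
      forall s : R, 1 <= s -> eta s = 1].

Definition cintegral (R : realType) (X : pointedMetricType R)
    (mu : {measure set (borel X) -> \bar R}) (F : X -> R[i]) : R[i] :=
  Rintegral mu [set: borel X] (fun y => complex.Re (F y)) +i*
  Rintegral mu [set: borel X] (fun y => complex.Im (F y)).

Definition T_trunc (R : realType) (X : pointedMetricType R)
    (mu : {measure set (borel X) -> \bar R}) (eta : R -> R) (K : X -> X -> R[i])
    (e : R) (f : X -> R[i]) (x : X) : R[i] :=
  cintegral mu (fun y => (eta (mdist x y / e))%:C * K x y * f y).

(* Main.v *)
Require Import Defs.
From HB Require Import structures.
From mathcomp Require Import all_boot all_order all_algebra.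
From mathcomp Require Import all_classical all_reals all_analysis.
From mathcomp Require Import complex measurable_realfun.
From mathcomp Require Import ring lra.
Import Order.TTheory GRing.Theory Num.Theory.
Import numFieldNormedType.Exports.
Local Open Scope classical_set_scope.
Local Open Scope ring_scope.
Local Open Scope complex_scope.

Set Implicit Arguments.
Unset Strict Implicit.
Unset Printing Implicit Defensive.

(** The implication from the operators to the function 1 holds because 1 has
    norm 1 in the Lipschitz-Hölder space.

    For the converse, write
      [T e f x = f x * T e 1 x + integral of Ke x y * (f y - f x)].
    The increment of [f] is of order [mdist x y `^ beta], so the integrand has
    the singularity [mdist x y `^ (beta - n)], which the growth condition makes
    integrable ([near_integral_le]: sum over dyadic annuli).  This gives the
    bound on the supremum ([T_trunc_sup_le]).

    For the Hölder bound ([T_trunc_holder_le]) take points [x1], [x2] at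
    distance [r].  Within distance of order [r] the two integrals are estimated
    separately.  Far away, the truncated kernel is smooth in its first variable
    with constants that do not depend on [e] ([truncated_kernel_smooth]), and
    the resulting decay [mdist x1 y `^ (beta - gamma - n)] is integrable at
    infinity since [beta < gamma] ([far_integral_le]).  What is left is
    [f x2 - f x1] times the integral of the kernel at [x2] over the far region.
    That integral differs by a bounded amount from the image of 1 under the
    operator truncated at scale [max e r], which is bounded by hypothesis: the
    uniformity of the hypothesis in the truncation is essential here. *)

(** * Measurability of functions of the distance *)

Lemma powRN_le (R : realType) (a b p : R) : 0 < a -> a <= b -> 0 <= p -> b `^ (- p) <= a `^ (- p).
Proof.
move=> a0 ab p0; have b0 : 0 < b by exact: lt_le_trans ab.
rewrite !powRN lef_pV2 ?posrE ?powR_gt0//.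
by apply: ge0_ler_powR; rewrite ?nnegrE// ltW.
Qed.

Section BorelMeasurability.
Context {R : realType} {X : pointedMetricType R}.

(** The sigma-algebra is generated by the open sets, so it is enough that a
    Hölder function is continuous. *)
Lemma holder_measurable (g : X -> R) (L b : R) : 0 < b ->
  (forall y z, `|g y - g z| <= L * mdist y z `^ b) ->
  measurable_fun [set: borel X] (g : borel X -> R).
Proof.
move=> b0 gL.
have L0 : 0 < `|L| + 1 by rewrite ltr_wpDl.
apply: (measurability _ (RGenOpens.measurableE R)).
move=> _ [_ [a [c ->] <-]]; rewrite setTI; apply: sub_sigma_algebra.
have cg : continuous g.
  move=> y; apply/cvgrPdist_lt => e e0.
  have r0 : 0 < (e / (`|L| + 1)) `^ b^-1 by rewrite powR_gt0// divr_gt0.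
  apply: filterS (nbhsx_ballx y _ r0) => z; rewrite ballEmdist/= => dyz.
  apply: le_lt_trans (gL y z) _.
  have : mdist y z `^ b < e / (`|L| + 1).
    have -> : e / (`|L| + 1) = ((e / (`|L| + 1)) `^ b^-1) `^ b.
      by rewrite -powRrM mulVf ?gt_eqF// powRr1// divr_ge0// ltW.
    by apply: gt0_ltr_powR => //; rewrite ?nnegrE ?mdist_ge0 ?powR_ge0.
  rewrite ltr_pdivlMr// => h; apply: le_lt_trans h.
  rewrite mulrC ler_wpM2l ?powR_ge0//; have := ler_norm L; lra.
by move/continuousP: cg; apply; exact: interval_open.
Qed.

Lemma mdist_sub_le (x y z : X) : `|mdist x y - mdist x z| <= mdist y z.
Proof.
rewrite ler_norml; have := metric_triangle x y z.
by have := metric_triangle x z y; rewrite (metric_sym z y); lra.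
Qed.

Lemma measurable_mdist (x : X) :
  measurable_fun [set: borel X] (mdist x : borel X -> R).
Proof.
apply: (@holder_measurable _ 1 1) => // y z.
by rewrite mul1r powRr1 ?mdist_ge0// mdist_sub_le.
Qed.

Lemma measurable_mdist_powR (x : X) (p : R) :
  measurable_fun [set: borel X] ((fun y => mdist x y `^ p) : borel X -> R).
Proof. exact: measurableT_comp (measurable_powR p) (measurable_mdist x). Qed.

Lemma measurable_mdist_preim (x : X) (I : interval R) :
  measurable ([set y | mdist x y \in I] : set (borel X)).
Proof.
rewrite [X in measurable X](_ : _ = setT `&` (mdist x : borel X -> R) @^-1` [set` I]).
  by apply: measurable_mdist => //; exact: measurable_itv.
by rewrite setTI.
Qed.

Lemma borel_measurable_set1 (x : X) : measurable ([set x] : set (borel X)).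
Proof.
rewrite [X in measurable X](_ : _ = [set y | mdist x y \in `]-oo, 0]]).
  exact: measurable_mdist_preim.
apply/seteqP; split => y /=; rewrite in_itv/=; first by move=> ->; rewrite mdistxx.
by move=> d0; apply/esym/mdist_positivity/eqP; rewrite eq_le d0 mdist_ge0.
Qed.

End BorelMeasurability.

(** * Integrals of powers of the distance *)

Section DyadicAnnuli.
Context {R : realType} {X : pointedMetricType R}.
Variables (mu : {measure set (borel X) -> \bar R}) (A n : R).
Hypotheses (A0 : 0 < A).
Hypothesis growth : forall (x : X) (r : R), 0 < r ->
  (mu (ball x r) <= (A * r `^ n)%:E)%E.

Definition annulus (x : X) (r : R) : set (borel X) :=
  [set y | r <= mdist x y < 2 * r].

Lemma measurable_annulus x r : measurable (annulus x r).
Proof.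
rewrite [X in measurable X](_ : _ = [set y | mdist x y \in `[r, 2 * r[]).
  exact: measurable_mdist_preim.
by apply/seteqP; split => y /=; rewrite in_itv.
Qed.

Lemma measurable_borel_ball (x : X) (r : R) :
  measurable (ball x r : set (borel X)).
Proof.
rewrite [X in measurable X](_ : _ = [set y | mdist x y \in `]-oo, r[]).
  exact: measurable_mdist_preim.
by rewrite ballEmdist; apply/seteqP; split => y /=; rewrite in_itv.
Qed.

(** The integrand is at most [r `^ (- p)], and the annulus lies in the ball of
    radius [2 * r], whose mass the growth condition controls. *)
Lemma annulus_integral_le x r p : 0 < r -> 0 <= p ->
  (\int[mu]_(y in annulus x r) (mdist x y `^ (- p))%:E <=
    (A * 2 `^ n * r `^ (n - p))%:E)%E.
Proof.
move=> r0 p0.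
apply: (@le_trans _ _ (\int[mu]_(y in annulus x r) (cst (r `^ (- p))%:E y))%E).
  apply: ge0_le_integral => //=.
  - exact: measurable_annulus.
  - by move=> y _; rewrite lee_fin powR_ge0.
  - by apply/measurable_EFinP; apply: measurable_funTS; exact: measurable_mdist_powR.
  - by move=> y /andP[ry _]; rewrite lee_fin; exact: powRN_le.
rewrite integral_cst; last exact: measurable_annulus.
apply: (@le_trans _ _ ((r `^ (- p))%:E * (A * (2 * r) `^ n)%:E)%E).
  rewrite lee_wpmul2l ?lee_fin ?powR_ge0//.
  apply: le_trans (growth x _) => //; last by rewrite mulr_gt0.
  apply: le_measure; rewrite ?inE; [exact: measurable_annulus|exact: measurable_borel_ball|].
  by move=> y /andP[_]; rewrite ballEmdist.
rewrite -EFinM lee_fin powRM ?(ltW r0)// powRD; last by rewrite (gt_eqF r0) implybT.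
by rewrite le_eqVlt; apply/orP; left; apply/eqP; ring.
Qed.

Lemma geometric_nneseries_le (M q : R) : 0 <= M -> 0 <= q < 1 ->
  (\sum_(0 <= k <oo) (M * q ^+ k)%:E <= (M / (1 - q))%:E)%E.
Proof.
move=> M0 /andP[q0 q1]; apply: lime_le.
  by apply: is_cvg_nneseries => k _ _; rewrite lee_fin mulr_ge0// exprn_ge0.
near=> k; rewrite sumEFin lee_fin.
have := geometric_seriesE M (negbT (lt_eqF q1)).
move/(congr1 (fun f : nat -> R => f k)); rewrite /series/= => ->.
rewrite ler_wpM2r ?invr_ge0 ?subr_ge0 ?(ltW q1)//.
by rewrite -[leRHS]mulr1 ler_wpM2l// gerBl exprn_ge0.
Unshelve. all: by end_near. Qed.

(** Every annulus contributes a term of a geometric sequence of ratio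
    [q `^ (n - p)].  The alternative on [q], halving or doubling the radii,
    makes the annuli disjoint: one statement serves the annuli that shrink to
    the centre and those that grow to infinity. *)
Lemma dyadic_integral_le x (r q p : R) : 0 < r -> 0 < q -> 0 <= p ->
  2 * q <= 1 \/ 2 <= q -> q `^ (n - p) < 1 ->
  (\int[mu]_(y in \bigcup_k annulus x (r * q ^+ k)) (mdist x y `^ (- p))%:E <=
    (A * 2 `^ n * r `^ (n - p) / (1 - q `^ (n - p)))%:E)%E.
Proof.
move=> r0 q0 p0 q2 q1.
rewrite ge0_integral_bigcup//; last 4 first.
- by move=> k; exact: measurable_annulus.
- by apply/measurable_EFinP; apply: measurable_funTS; exact: measurable_mdist_powR.
- by move=> y _; rewrite lee_fin powR_ge0.
- apply: ltn_trivIset => l k kl; rewrite -subset0 => y /= [].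
  move=> /andP[ky yk] /andP[ly yl].
  have rq : 0 < r * q ^+ k by rewrite mulr_gt0// exprn_gt0.
  have lk : q ^+ l = q ^+ (l - k).-1 * q * q ^+ k.
    by rewrite -exprSr -exprD prednK ?subn_gt0// subnK// ltnW.
  rewrite lk in ly yl.
  case: q2 => q2.
  + have h : q ^+ (l - k).-1 <= 1 by rewrite exprn_ile1 ?ltW//; lra.
    have h1 : q ^+ (l - k).-1 * (2 * q) <= 1.
      by rewrite mulr_ile1 ?exprn_ge0 ?mulr_ge0// ltW.
    have : 2 * (r * (q ^+ (l - k).-1 * q * q ^+ k)) <= r * q ^+ k.
      rewrite (_ : 2 * _ = q ^+ (l - k).-1 * (2 * q) * (r * q ^+ k)); last by ring.
      by rewrite ler_piMl// ltW.
    lra.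
  + have h : 1 <= q ^+ (l - k).-1 by rewrite exprn_ege1//; lra.
    have h1 : 2 <= q ^+ (l - k).-1 * q.
      by apply: le_trans q2 _; rewrite ler_peMl// ltW.
    have : 2 * (r * q ^+ k) <= r * (q ^+ (l - k).-1 * q * q ^+ k).
      rewrite (_ : r * (_ * _) = (q ^+ (l - k).-1 * q) * (r * q ^+ k)); last by ring.
      by rewrite ler_wpM2r// ltW.
    lra.
apply: le_trans; last first.
  apply: geometric_nneseries_le; last by rewrite powR_ge0 q1.
  by rewrite !mulr_ge0 ?powR_ge0// ltW.
apply: lee_nneseries => [k _ _|k _].
  by apply: integral_ge0 => y _; rewrite lee_fin powR_ge0.
apply: le_trans (annulus_integral_le x _ p0) _.
  by rewrite mulr_gt0// exprn_gt0.
rewrite powRM ?exprn_ge0 ?(ltW r0) ?(ltW q0)//.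
rewrite -(powR_mulrn k (ltW q0)) -(powR_mulrn k (powR_ge0 _ _)) powRAC mulrA.
exact: lexx.
Qed.

Lemma exists_expr_gt (t : R) : exists k, t < 2 ^+ k.
Proof.
exists (Num.bound t); have := archi_boundP (normr_ge0 t).
move=> /(le_lt_trans (ler_norm t)) /lt_le_trans; apply.
rewrite /Num.bound ger0_norm ?normr_ge0// -natrX ler_nat ltnW//.
exact: ltn_expl.
Qed.

(** The sum of the geometric series produced by the annuli: it bounds both the
    integral near the centre and the integral at infinity. *)
Definition dyadic_const (t : R) : R := A * 2 `^ n / (1 - 2 `^ (- t)).

Lemma powR2N_lt1 (t : R) : 0 < t -> 2 `^ (- t) < 1.
Proof.
move=> t0; rewrite powRN invf_lt1 ?powR_gt0//.
have : (1 : R) `^ t < 2 `^ t by apply: gt0_ltr_powR => //; rewrite ?nnegrE// ltr1n.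
by rewrite powR1.
Qed.

Lemma dyadic_const_gt0 t : 0 < t -> 0 < dyadic_const t.
Proof. by move=> t0; rewrite divr_gt0 ?mulr_gt0 ?powR_gt0// subr_gt0 powR2N_lt1. Qed.

(** The singularity [t - n] is integrable for [t > 0], by summing over annuli of
    radii [r / 2, r / 4, ...]; the centre is left out because the power of the
    distance has no meaning there. *)
Lemma near_integral_le x (r t : R) : 0 < r -> 0 < t -> t <= n ->
  (\int[mu]_(y in [set y | (0 < mdist x y < r)%R]) (mdist x y `^ (t - n))%:E <=
    (dyadic_const t * r `^ t)%:E)%E.
Proof.
move=> r0 t0 tn.
rewrite [X in integral _ X _](_ : _ = \bigcup_k annulus x (r / 2 * 2^-1 ^+ k)); last first.
  apply/seteqP; split => y /=.
  - move=> /andP[d0 dr].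
    (* the least k that works gives the annulus containing y *)
    have ex : exists k, r / 2 * 2^-1 ^+ k <= mdist x y.
      have [k] := exists_expr_gt (r / 2 / mdist x y).
      rewrite ltr_pdivrMr// => h; exists k.
      by rewrite exprVn ler_pdivrMr ?exprn_gt0//; lra.
    exists (ex_minn ex) => //; rewrite /annulus/=; case: ex_minnP => k kd kmin.
    rewrite kd/=; case: k kd kmin => [|k] kd kmin; first by rewrite expr0; lra.
    rewrite ltNge; apply/negP => h.
    suff /kmin : r / 2 * 2^-1 ^+ k <= mdist x y by rewrite ltnn.
    by move: h; rewrite exprS; lra.
  - move=> [k _] /andP[rd dr].
    have h0 : 0 < (2^-1 : R) ^+ k by rewrite exprn_gt0.
    have h1 : (2^-1 : R) ^+ k <= 1 by rewrite exprn_ile1//; lra.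
    rewrite (lt_le_trans _ rd) ?mulr_gt0//= ?divr_gt0//.
    apply: lt_le_trans dr _; rewrite mulrA mulrCA divff// mulr1.
    by rewrite ler_piMr ?(ltW r0).
rewrite (_ : t - n = - (n - t)); last by ring.
have e : n - (n - t) = t by ring.
have e2 : 2^-1 `^ t = 2 `^ (- t) :> R.
  by rewrite -powR_inv1// -powRrM mulN1r.
apply: le_trans (dyadic_integral_le x _ _ _ _ _) _; rewrite ?e ?e2 ?divr_gt0 ?subr_ge0//.
- by left; rewrite divff.
- exact: powR2N_lt1.
rewrite lee_fin mulrAC ler_wpM2l ?(ltW (dyadic_const_gt0 t0))//.
by apply: ge0_ler_powR; rewrite ?nnegrE ?(ltW t0)//; lra.
Qed.

(** The decay is faster than the dimension by [t], so the annuli of radii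
    [r, 2 * r, ...] add up to the order [r `^ (- t)] of the first one. *)
Lemma far_integral_le x (r t : R) : 0 < r -> 0 < t -> 0 <= n ->
  (\int[mu]_(y in [set y | (r <= mdist x y)%R]) (mdist x y `^ (- (n + t)))%:E <=
    (dyadic_const t * r `^ (- t))%:E)%E.
Proof.
move=> r0 t0 n0.
rewrite [X in integral _ X _](_ : _ = \bigcup_k annulus x (r * 2 ^+ k)); last first.
  apply/seteqP; split => y /=.
  - move=> rd.
    have ex : exists k, mdist x y < r * 2 ^+ k.
      have [k] := exists_expr_gt (mdist x y / r).
      by rewrite ltr_pdivrMr// mulrC => h; exists k.
    case: (ex_minnP ex) => -[|k] kd kmin; first by move: kd; rewrite expr0; lra.
    exists k => //; rewrite /annulus/= mulrCA -exprS kd andbT leNgt.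
    by apply/negP => /kmin; rewrite ltnn.
  - move=> [k _] /andP[rd _]; apply: le_trans rd.
    by rewrite ler_peMr ?(ltW r0)// exprn_ege1// ler1n.
have e : n - (n + t) = - t by ring.
apply: le_trans (dyadic_integral_le x _ _ _ _ _) _; rewrite ?e ?addr_ge0 ?(ltW t0)//.
- by right.
- exact: powR2N_lt1.
by rewrite lee_fin mulrAC.
Qed.

End DyadicAnnuli.

(** * Complex-valued integrals *)

Section ComplexModulus.
Context {R : realType}.
Implicit Types z w : R[i].

Lemma cmod_ge0 z : 0 <= cmod z.
Proof. by case: z => a b; exact: sqrtr_ge0. Qed.

Lemma cmod0 : cmod (0 : R[i]) = 0. Proof. exact: Normc.normc0. Qed.

Lemma cmod1 : cmod (1 : R[i]) = 1. Proof. exact: Normc.normc1. Qed.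

Lemma cmodM z w : cmod (z * w) = cmod z * cmod w.
Proof. exact: Normc.normcM. Qed.

Lemma cmodD_le z w : cmod (z + w) <= cmod z + cmod w.
Proof. exact: le_normcD. Qed.

Lemma cmodN z : cmod (- z) = cmod z.
Proof. exact: normcN. Qed.

Lemma cmodB_le z w : cmod (z - w) <= cmod z + cmod w.
Proof. by rewrite -(cmodN w) cmodD_le. Qed.

Lemma cmodBC z w : cmod (z - w) = cmod (w - z).
Proof. by rewrite -cmodN opprB. Qed.

Lemma cmod_real (r : R) : cmod (r%:C)%C = `|r|.
Proof. by rewrite /cmod /= expr0n addr0 sqrtr_sqr. Qed.

Lemma normr_Re_le z : `|complex.Re z| <= cmod z.
Proof. by case: z => a b /=; rewrite -sqrtr_sqr ler_wsqrtr// lerDl sqr_ge0. Qed.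

Lemma normr_Im_le z : `|complex.Im z| <= cmod z.
Proof. by case: z => a b /=; rewrite -sqrtr_sqr ler_wsqrtr// lerDr sqr_ge0. Qed.

Lemma cmod_le_ReIm z : cmod z <= `|complex.Re z| + `|complex.Im z|.
Proof.
rewrite {1}[z]complexE; apply: le_trans (cmodD_le _ _) _.
by rewrite cmodM !cmod_real /cmod /= expr0n/= add0r expr1n sqrtr1 mul1r.
Qed.

Lemma ReD z w : complex.Re (z + w) = complex.Re z + complex.Re w.
Proof. by case: z; case: w. Qed.

Lemma ImD z w : complex.Im (z + w) = complex.Im z + complex.Im w.
Proof. by case: z; case: w. Qed.

Lemma ReM z w : complex.Re (z * w) =
  complex.Re z * complex.Re w - complex.Im z * complex.Im w.
Proof. by case: z; case: w. Qed.

Lemma ImM z w : complex.Im (z * w) =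
  complex.Re z * complex.Im w + complex.Im z * complex.Re w.
Proof. by case: z; case: w. Qed.

End ComplexModulus.

Section BoundedMeasurable.
Context {R : realType} {X : pointedMetricType R}.
Implicit Types F G : X -> R[i].

(** On a finite measure space this suffices for integrability, and unlike
    integrability it is stable under products. *)
Definition bounded_measurable F : Prop :=
  [/\ measurable_fun [set: borel X] ((fun y => complex.Re (F y)) : borel X -> R),
      measurable_fun [set: borel X] ((fun y => complex.Im (F y)) : borel X -> R) &
      exists M : R, forall y, cmod (F y) <= M].

Lemma bounded_measurable_cst (c : R[i]) : bounded_measurable (fun=> c).
Proof. by split; [exact: measurable_cst|exact: measurable_cst|exists (cmod c)]. Qed.

Lemma bounded_measurableD F G : bounded_measurable F -> bounded_measurable G ->
  bounded_measurable (fun y => F y + G y).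
Proof.
move=> [FR FI [M FM]] [GR GI [N GN]]; split.
- by under eq_fun do rewrite ReD; exact: measurable_funD.
- by under eq_fun do rewrite ImD; exact: measurable_funD.
- by exists (M + N) => y; rewrite (le_trans (cmodD_le _ _))// lerD.
Qed.

Lemma bounded_measurableM F G : bounded_measurable F -> bounded_measurable G ->
  bounded_measurable (fun y => F y * G y).
Proof.
move=> [FR FI [M FM]] [GR GI [N GN]]; split.
- under eq_fun do rewrite ReM.
  by apply: measurable_funB; exact: measurable_funM.
- under eq_fun do rewrite ImM.
  by apply: measurable_funD; exact: measurable_funM.
- by exists (M * N) => y; rewrite cmodM ler_pM ?cmod_ge0.
Qed.

Lemma bounded_measurableB F G : bounded_measurable F -> bounded_measurable G ->
  bounded_measurable (fun y => F y - G y).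
Proof.
move=> bF bG; under eq_fun do rewrite -mulN1r.
apply: bounded_measurableD => //; apply: bounded_measurableM => //.
exact: bounded_measurable_cst.
Qed.

Lemma bounded_measurable_real (h : X -> R) (M : R) :
  measurable_fun [set: borel X] (h : borel X -> R) -> (forall y, `|h y| <= M) ->
  bounded_measurable (fun y => (h y)%:C)%C.
Proof.
move=> mh hM; split.
- exact: mh.
- exact: (@measurable_cst _ _ (borel X) R setT 0).
- by exists M => y; rewrite cmod_real.
Qed.

End BoundedMeasurable.

Section ComplexIntegral.
Context {R : realType} {X : pointedMetricType R}.
Variable mu : {finite_measure set (borel X) -> \bar R}.
Implicit Types F G : X -> R[i].

Lemma bounded_integrable (u : borel X -> R) (M : R) :
  measurable_fun setT u -> (forall y, `|u y| <= M) ->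
  mu.-integrable setT (EFin \o u).
Proof.
move=> mu_ uM; apply: measurable_bounded_integrable => //.
  by rewrite ltey_eq fin_num_measure.
exists M; split => [|x Mx y _]; first exact: num_real.
exact: le_trans (uM y) (ltW Mx).
Qed.

Lemma bounded_measurable_integrable F : bounded_measurable F ->
  mu.-integrable setT (EFin \o (fun y : borel X => complex.Re (F y))) /\
  mu.-integrable setT (EFin \o (fun y : borel X => complex.Im (F y))).
Proof.
move=> [FR FI [M FM]]; split; apply: (@bounded_integrable _ M) => // y.
- exact: le_trans (normr_Re_le _) (FM y).
- exact: le_trans (normr_Im_le _) (FM y).
Qed.

Lemma cintegralD F G : bounded_measurable F -> bounded_measurable G ->
  cintegral mu (fun y => F y + G y) = cintegral mu F + cintegral mu G.
Proof.
move=> /bounded_measurable_integrable[FR FI] /bounded_measurable_integrable[GR GI].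
rewrite /cintegral.
under eq_Rintegral do rewrite ReD.
under [X in _ +i* X]eq_Rintegral do rewrite ImD.
by rewrite !RintegralD.
Qed.

Lemma cintegralZ (c : R[i]) F : bounded_measurable F ->
  cintegral mu (fun y => c * F y) = c * cintegral mu F.
Proof.
move=> /bounded_measurable_integrable[FR FI].
have iZ (r : R) (u : borel X -> R) : mu.-integrable setT (EFin \o u) ->
    mu.-integrable setT (EFin \o (fun y => r * u y)).
  move=> iu; have := integrableZl measurableT r iu.
  by apply: eq_integrable => // y _ /=; rewrite EFinM.
rewrite /cintegral; case: c => a b.
under eq_Rintegral do rewrite ReM.
under [X in _ +i* X]eq_Rintegral do rewrite ImM.
by rewrite RintegralB ?RintegralD//=; try exact: iZ; rewrite !RintegralZl.
Qed.

Lemma cintegralB F G : bounded_measurable F -> bounded_measurable G ->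
  cintegral mu (fun y => F y - G y) = cintegral mu F - cintegral mu G.
Proof.
move=> bF bG; under [in LHS]eq_fun do rewrite -mulN1r.
rewrite cintegralD ?cintegralZ ?mulN1r//.
by apply: bounded_measurableM => //; exact: bounded_measurable_cst.
Qed.

Lemma Rintegral_dominated_le (D : set (borel X)) (u g : borel X -> R) (c M : R) :
  measurable D -> measurable_fun setT u -> measurable_fun D g -> 0 <= c ->
  (forall y, ~ D y -> u y = 0) -> (forall y, D y -> 0 <= g y) ->
  (forall y, D y -> `|u y| <= c * g y) ->
  (\int[mu]_(y in D) (g y)%:E <= M%:E)%E ->
  `|Rintegral mu [set: borel X] u| <= c * M.
Proof.
move=> mD mu_ mg c0 u0 g0 ug gM.
have int_abs : (\int[mu]_y `|(u y)%:E| <= (c * M)%:E)%E.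
  rewrite (_ : (fun _ => _) = (fun y => `|(u y)%:E|)%E \_ D); last first.
    apply/funext => y; rewrite patchE; case: ifPn => // /negP.
    by rewrite inE => /u0 ->; rewrite abse0.
  rewrite -integral_mkcond.
  apply: (@le_trans _ _ (\int[mu]_(y in D) (c%:E * (g y)%:E))%E).
    apply: ge0_le_integral => //.
    - by apply: measurableT_comp => //; apply/measurable_EFinP; exact: measurable_funTS.
    - by apply: measurable_funeM; exact/measurable_EFinP.
  rewrite ge0_integralZl_EFin//; first by rewrite EFinM lee_wpmul2l// lee_fin.

  exact/measurable_EFinP.
rewrite -lee_fin /Rintegral.
have h : (`|\int[mu]_y (u y)%:E| <= (c * M)%:E)%E.
  apply: le_trans int_abs; apply: le_abse_integral => //.
  exact/measurable_EFinP.
move: h; case: (\int[mu]_y (u y)%:E)%E => [r| |]//=.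
Qed.

(** The factor 2 comes from bounding the real and the imaginary part
    separately. *)
Lemma cintegral_dominated_le (D : set (borel X)) F (g : borel X -> R) (c M : R) :
  measurable D -> bounded_measurable F -> measurable_fun D g -> 0 <= c ->
  (forall y, ~ D y -> F y = 0) -> (forall y, D y -> 0 <= g y) ->
  (forall y, D y -> cmod (F y) <= c * g y) ->
  (\int[mu]_(y in D) (g y)%:E <= M%:E)%E ->
  cmod (cintegral mu F) <= 2 * (c * M).
Proof.
move=> mD [FR FI _] mg c0 F0 g0 Fg gM.
rewrite mulrDl mul1r; apply: le_trans (cmod_le_ReIm _) _; rewrite lerD//=.
- apply: (@Rintegral_dominated_le D _ g) => // y; first by move/F0 => ->.
  by move/Fg; exact: le_trans (normr_Re_le _).
- apply: (@Rintegral_dominated_le D _ g) => // y; first by move/F0 => ->.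
  by move/Fg; exact: le_trans (normr_Im_le _).
Qed.

End ComplexIntegral.

(** * The cutoff function *)

Section CutoffLipschitz.
Context {R : realType}.

(** At an interior point of the half-line the limit along the half-line is the
    two-sided derivative. *)
Lemma C1_halfline_is_derive (h h' : R -> R) (s : R) : 0 < s ->
  (h t - h s) / (t - s) @[t --> within [set t | 0 <= t] s^'] --> h' s ->
  is_derive s 1 h (h' s).
Proof.
move=> s0 hs.
have lim : (fun u : R => u^-1 *: ((h \o shift s) (u *: 1) - h s)) @ 0^' --> h' s.
  apply/cvgrPdist_lt => e e0.
  move/cvgrPdist_lt : hs => /(_ e e0); rewrite near_withinE.
  rewrite /dnbhs !near_withinE => /nbhs_ballP[d /= d0 hd].
  apply/nbhs_ballP; exists (Num.min d s) => /=; first by rewrite lt_min d0.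
  move=> u; rewrite /ball/= sub0r normrN lt_min => /andP[ud us] u0.
  have := hd (u + s); rewrite /ball/= opprD addrCA subrr addr0 normrN.
  rewrite addrK [h (u + s)]/= [u *: 1]mulr1 [_ *: _]mulrC; apply => //.
    by rewrite -subr_eq0 addrK.
  by move: us; rewrite ltr_norml; lra.
have dv : derivable h s 1 by apply/cvg_ex; exists (h' s).
by apply: DeriveDef => //; exact: cvg_lim lim.
Qed.

Lemma clamp_sub_le (a b s t : R) : a <= b -> s <= t ->
  Num.max a (Num.min t b) - Num.max a (Num.min s b) <= t - s.
Proof.
move=> ab st; rewrite lerBlDl ge_max; apply/andP; split.
  have : a <= Num.max a (Num.min s b) by rewrite le_max lexx.
  lra.
have [sb|bs] := leP s b; last first.
  have : Num.min t b <= Num.max a b by rewrite ge_min !le_max lexx !orbT.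
  lra.
have : Num.min t b <= t by rewrite ge_min lexx.
have : s <= Num.max a s by rewrite le_max lexx orbT.
lra.
Qed.

(** On [1/2, 1] the derivative is bounded, by continuity on a compact interval;
    outside it the cutoff is constant, so its value at [s] is its value at the
    point of [1/2, 1] nearest to [s], and this projection does not increase
    distances. *)
Lemma cutoff_lipschitz (eta : R -> R) : cutoff eta ->
  exists2 L : R, 0 <= L & forall s t, 0 <= s -> 0 <= t ->
    `|eta s - eta t| <= L * `|s - t|.
Proof.
move=> [[h' [ch' deta]] _ eta0 eta1].
have ab : 2^-1 <= (1 : R) by lra.
have ch : {within `[2^-1, 1], continuous h'}.
  apply: continuous_subspaceW ch' => x /=; rewrite !in_itv/= andbT; lra.
have [c cI cmax] := EVT_max ab ch; have [d dI dmin] := EVT_min ab ch.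
pose L := `|h' c| + `|h' d|.
have h'L x : x \in `[2^-1, 1] -> `|h' x| <= L.
  move=> xI; have := cmax x xI; have := dmin x xI; rewrite /L ler_norml.
  have := ler_norm (h' c); have := ler_norm (- h' d); rewrite normrN.
  have := normr_ge0 (h' c); have := normr_ge0 (h' d); lra.
have L0 : 0 <= L by rewrite addr_ge0.
have core s t : 2^-1 <= s -> s <= t -> t <= 1 -> `|eta s - eta t| <= L * `|s - t|.
  move=> s2 st t1.
  have der x : x \in `[s, t] -> is_derive x 1 eta (h' x).
    rewrite in_itv/= => /andP[sx xt]; apply: C1_halfline_is_derive; first lra.
    by apply: deta; lra.
  have dero x : x \in `]s, t[ -> is_derive x 1 eta (h' x).
    by rewrite in_itv/= => /andP[sx xt]; apply: der; rewrite in_itv/= !ltW.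
  have ceta : {within `[s, t], continuous eta}.
    apply: derivable_within_continuous => x xI.
    exact: (@ex_derive _ _ _ _ _ _ _ (der x xI)).
  have [x xI eqn] := MVT_segment st dero ceta.
  rewrite distrC eqn normrM [`|s - t|]distrC ler_wpM2r//; apply: h'L.
  by move: xI; rewrite !in_itv/= => /andP[sx xt]; lra.
pose clamp (s : R) := Num.max 2^-1 (Num.min s 1).
exists L => // s t.
wlog st : s t / s <= t.
  move=> H s0 t0; have [st|/ltW ts] := leP s t; first exact: H.
  by rewrite distrC [`|s - t|]distrC; exact: H.
move=> s0 t0.
have etac u : 0 <= u -> eta u = eta (clamp u).
  move=> u0; rewrite /clamp minEle maxEle; case: (leP u 1) => u1.
    by case: (leP 2^-1 u) => u2 //; rewrite !eta0//; lra.
  by rewrite ab !eta1// ltW.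
have cl u v : u <= v -> clamp u <= clamp v.
  by move=> uv; rewrite /clamp ge_max !le_max lexx/= le_min !ge_min uv lexx !orbT.
have cl1 u : 2^-1 <= clamp u <= 1 by rewrite /clamp le_max lexx ge_max ab ge_min lexx orbT.
have cl2 : clamp t - clamp s <= t - s by exact: clamp_sub_le.
rewrite etac// [eta t]etac//; apply: le_trans (core _ _ _ _ _) _.
- by case/andP: (cl1 s).
- exact: cl.
- by case/andP: (cl1 t).
rewrite ler_wpM2l// (distrC s) (distrC (clamp s)) !ger0_norm ?subr_ge0//; exact: cl.
Qed.

End CutoffLipschitz.

(** * The truncated kernel *)

Definition truncated_kernel {R : realType} {X : pointedMetricType R}
  (eta : R -> R) (K : X -> X -> R[i]) (e : R) (x y : X) : R[i] :=
  (eta (mdist x y / e))%:C * K x y.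

Section TruncatedKernel.
Context {R : realType} {X : pointedMetricType R}.
Variables (n g C1 C2 L : R) (K : X -> X -> R[i]) (eta : R -> R).
Hypotheses (n0 : 0 < n) (g0 : 0 < g) (g1 : g <= 1).
Hypotheses (C1_ge0 : 0 <= C1) (C2_ge0 : 0 <= C2) (L_ge0 : 0 <= L).
Hypothesis K_size : forall x y, x <> y -> cmod (K x y) <= C1 * mdist x y `^ (- n).
Hypothesis K_smooth : forall x1 x2 y, x1 <> y -> x2 <> y ->
  2 * mdist x1 x2 <= mdist x1 y ->
  cmod (K x1 y - K x2 y) <= C2 * (mdist x1 x2 `^ g * mdist x1 y `^ (- (n + g))).
Hypothesis K_meas : measurable_sections K.
Hypothesis eta01 : forall s, 0 <= s -> 0 <= eta s <= 1.
Hypothesis eta_eq0 : forall s, 0 <= s <= 2^-1 -> eta s = 0.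
Hypothesis eta_eq1 : forall s, 1 <= s -> eta s = 1.
Hypothesis eta_lip : forall s t, 0 <= s -> 0 <= t ->
  `|eta s - eta t| <= L * `|s - t|.

Local Notation Ke := (truncated_kernel eta K).

Lemma truncated_kernel_eq0 e x y : 0 < e -> mdist x y <= e / 2 -> Ke e x y = 0.
Proof.
move=> e0 d; rewrite /truncated_kernel eta_eq0 ?mul0r//.
by rewrite divr_ge0 ?mdist_ge0 ?(ltW e0)//= ler_pdivrMr// mulrC.
Qed.

Lemma truncated_kernelE e x y : 0 < e -> e <= mdist x y -> Ke e x y = K x y.
Proof.
by move=> e0 d; rewrite /truncated_kernel eta_eq1 ?mul1r// ler_pdivlMr// mul1r.
Qed.

Lemma truncated_kernel_size e x y : 0 < e -> x <> y ->
  cmod (Ke e x y) <= C1 * mdist x y `^ (- n).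
Proof.
move=> e0 xy; rewrite /truncated_kernel cmodM cmod_real.
apply: le_trans (K_size xy); rewrite ler_piMl ?cmod_ge0//.
have /andP[h0 h1] := eta01 (divr_ge0 (mdist_ge0 x y) (ltW e0)).
by rewrite ger0_norm.
Qed.

(** The truncation vanishes at distance at most [e / 2], so the kernel never
    sees its singularity.  The free parameter [t <= e] allows a bound at a scale
    smaller than that of the truncation. *)
Lemma truncated_kernel_bounded e t x y : 0 < t -> t <= e ->
  cmod (Ke e x y) <= C1 * (t / 2) `^ (- n).
Proof.
move=> t0 te; have e0 : 0 < e by exact: lt_le_trans te.
have [d|d] := leP (mdist x y) (e / 2).
  by rewrite truncated_kernel_eq0// cmod0 mulr_ge0 ?powR_ge0.
have xy : x <> y by move=> exy; move: d; rewrite exy mdistxx; lra.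
apply: le_trans (truncated_kernel_size e0 xy) _.
by rewrite ler_wpM2l// powRN_le ?(ltW n0)//; lra.
Qed.

(** Truncation preserves the smoothness condition uniformly in [e].  The new
    term is the increment of the cutoff times [K x2 y]: the increment is nonzero
    only if [mdist x1 y < 2 * e], and then the Lipschitz bound [r / e] is of
    order [r / mdist x1 y], hence of order its power [g <= 1]. *)
Lemma truncated_kernel_smooth e x1 x2 y : 0 < e -> x1 <> y ->
  2 * mdist x1 x2 <= mdist x1 y ->
  cmod (Ke e x1 y - Ke e x2 y) <=
    (C2 + 2 * L * C1 * 2 `^ n) * mdist x1 x2 `^ g * mdist x1 y `^ (- (n + g)).
Proof.
move=> e0 x1y d12; set r := mdist x1 x2 in d12 *; set d1 := mdist x1 y in d12 *.
have d10 : 0 < d1 by rewrite mdist_gt0; exact/eqP.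
have r0 : 0 <= r by exact: mdist_ge0.
set d2 := mdist x2 y.
have d2d1 : d1 / 2 <= d2.
  by have := metric_triangle x1 x2 y; rewrite -/r -/d1 -/d2; lra.
have d20 : 0 < d2 by lra.
have dd : `|d1 - d2| <= r.
  have := mdist_sub_le y x1 x2.
  by rewrite (metric_sym y x1) (metric_sym y x2).
have x2y : x2 <> y by apply/eqP; rewrite -mdist_gt0.
have eta_near : `|eta (d1 / e) - eta (d2 / e)| <= 2 * L * (r / d1) `^ g.
  have [le1|lt1] := leP (2 * e) d1.
    rewrite !eta_eq1 ?ler_pdivlMr// ?subrr ?normr0 ?mulr_ge0 ?powR_ge0//; lra.
  apply: (@le_trans _ _ (2 * L * (r / d1))).
    apply: le_trans (eta_lip _ _) _; rewrite ?divr_ge0 ?(ltW e0) ?(ltW d10) ?(ltW d20)//.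
    rewrite -mulrBl normrM [`|e^-1|]gtr0_norm ?invr_gt0// (mulrC 2) -(mulrA L).
    rewrite ler_wpM2l// ler_pdivrMr//; apply: le_trans dd _.
    rewrite (_ : _ * e = (r / d1) * (2 * e)); last by ring.
    rewrite -[leLHS](divfK (lt0r_neq0 d10)) ler_wpM2l ?divr_ge0// ?(ltW d10)//.
    exact: ltW.
  rewrite ler_wpM2l ?mulr_ge0//.
  have [->|rn0] := eqVneq r 0; first by rewrite mul0r powR_ge0.
  have r_gt0 : 0 < r by rewrite lt_neqAle eq_sym rn0.
  apply: ger1_powR => //; rewrite divr_gt0//=.
  by rewrite ler_pdivrMr//; lra.
have rd : (r / d1) `^ g * d1 `^ (- n) = r `^ g * d1 `^ (- (n + g)).
  rewrite powRM ?invr_ge0 ?(ltW d10)// -powR_inv1 ?(ltW d10)// -powRrM mulN1r -mulrA.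
  by rewrite -powRD ?(gt_eqF d10) ?implybT// -opprD addrC.
have -> : Ke e x1 y - Ke e x2 y = (eta (d1 / e))%:C * (K x1 y - K x2 y) +
    (eta (d1 / e) - eta (d2 / e))%:C * K x2 y.
  by rewrite /truncated_kernel -/d1 -/d2 rmorphB/=; ring.
apply: le_trans (cmodD_le _ _) _; rewrite !cmodM !cmod_real.
have h1 : `|eta (d1 / e)| * cmod (K x1 y - K x2 y) <= C2 * (r `^ g * d1 `^ (- (n + g))).
  apply: le_trans (K_smooth x1y x2y d12); rewrite ler_piMl ?cmod_ge0//.
  have /andP[? ?] := eta01 (divr_ge0 (ltW d10) (ltW e0)).
  by rewrite ger0_norm.
have h2 : `|eta (d1 / e) - eta (d2 / e)| * cmod (K x2 y) <=
    2 * L * C1 * 2 `^ n * (r `^ g * d1 `^ (- (n + g))).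
  rewrite -rd.
  apply: (@le_trans _ _ (2 * L * (r / d1) `^ g * (C1 * (2 `^ n * d1 `^ (- n))))).
    rewrite ler_pM ?cmod_ge0//; apply: le_trans (K_size x2y) _.
    rewrite ler_wpM2l//.
    have -> : 2 `^ n * d1 `^ (- n) = (d1 / 2) `^ (- n).
      have h2n : 2^-1 `^ (- n) = 2 `^ n :> R by rewrite -powR_inv1// -powRrM mulrNN mul1r.
      by rewrite powRM ?(ltW d10)// h2n mulrC.
    by rewrite powRN_le ?divr_gt0 ?(ltW n0).
  by rewrite le_eqVlt; apply/orP; left; apply/eqP; ring.
by rewrite -[in leRHS]mulrA mulrDl lerD.
Qed.

(** The kernel is measurable off the diagonal only; at [x] itself the truncated
    kernel is zero. *)
Lemma bounded_measurable_truncated_kernel e x : 0 < e ->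
  bounded_measurable (Ke e x).
Proof.
move=> e0.
have meta : measurable_fun [set: borel X] ((fun y => eta (mdist x y / e)) : borel X -> R).
  apply: (@holder_measurable _ _ _ (L / e) 1) => // y z.
  rewrite powRr1 ?mdist_ge0//.
  apply: le_trans (eta_lip _ _) _; rewrite ?divr_ge0 ?mdist_ge0 ?(ltW e0)//.
  rewrite -mulrBl normrM [`|e^-1|]gtr0_norm ?invr_gt0// -mulrA ler_wpM2l//.
  by rewrite mulrC ler_wpM2l ?invr_ge0 ?(ltW e0)// mdist_sub_le.
have Dx : [set: borel X] = ~` [set x] `|` [set x] by rewrite setUC setUv.
have mx : measurable ([set x] : set (borel X)) by exact: borel_measurable_set1.
have split_mf (u : borel X -> R) : measurable_fun (~` [set x] : set (borel X)) u ->
    u x = 0 -> measurable_fun [set: borel X] u.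
  move=> um ux; rewrite Dx; apply/measurable_funU => //; first exact: measurableC.
  split => //.
  have m0 : measurable_fun ([set x] : set (borel X)) (cst 0 : borel X -> R).
    exact: measurable_cst.
  by apply: eq_measurable_fun m0 => y; rewrite inE/= => ->.
have Kxx : Ke e x x = 0 by rewrite truncated_kernel_eq0 ?mdistxx// ltW// divr_gt0.
have [mR mI] := K_meas x; split.
- apply: split_mf; last by rewrite Kxx.
  rewrite /truncated_kernel; under eq_fun do rewrite ReM/= mul0r subr0.
  by apply: measurable_funM => //; exact: measurable_funTS.
- apply: split_mf; last by rewrite Kxx.
  rewrite /truncated_kernel; under eq_fun do rewrite ImM/= mul0r addr0.
  by apply: measurable_funM => //; exact: measurable_funTS.
- by exists (C1 * (e / 2) `^ (- n)) => y; exact: truncated_kernel_bounded.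
Qed.

End TruncatedKernel.

(** * The Lipschitz-Hölder norm *)

Section LambdaNorm.
Context {R : realType} {X : pointedMetricType R}.
Variable b : R.
Implicit Types f : X -> R[i].

Lemma abs_values_neq0 f : abs_values f !=set0.
Proof. by exists (cmod (f point)), point. Qed.

(** On a one-point space there are no quotients; the supremum of the empty set
    is 0. *)
Lemma sup_holder_quotients_ge0 f : has_ubound (holder_quotients b f) ->
  0 <= sup (holder_quotients b f).
Proof.
move=> ub; have [->|/set0P[t tq]] := eqVneq (holder_quotients b f) set0.
  by rewrite sup0.
apply: le_trans (ub_le_sup ub tq).
by case: tq => x [y [_ ->]]; rewrite divr_ge0 ?cmod_ge0 ?powR_ge0.
Qed.

Lemma Lambda_normP f : Lambda b f ->
  (forall x, cmod (f x) <= Lambda_norm b f) /\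
  (forall x y, cmod (f x - f y) <= Lambda_norm b f * mdist x y `^ b).
Proof.
move=> [ub1 ub2]; have s2 := sup_holder_quotients_ge0 ub2.
have le1 x : cmod (f x) <= sup (abs_values f) by apply: ub_le_sup => //; exists x.
have s1 : 0 <= sup (abs_values f) := le_trans (cmod_ge0 (f point)) (le1 point).
split=> [x|x y]; first by rewrite (le_trans (le1 x))// lerDl.
have [->|/eqP xy] := eqVneq x y.
  by rewrite subrr cmod0 mulr_ge0 ?powR_ge0 ?addr_ge0.
rewrite -ler_pdivrMr ?powR_gt0 ?mdist_gt0 ?(introN eqP xy)//.
apply: le_trans (_ : sup (holder_quotients b f) <= _); last by rewrite lerDr.
by apply: ub_le_sup => //; exists x, y.
Qed.

Lemma Lambda_norm_ge0 f : Lambda b f -> 0 <= Lambda_norm b f.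
Proof. by move=> /Lambda_normP[h _]; exact: le_trans (cmod_ge0 _) (h point). Qed.

Lemma Lambda_norm_le f (M N : R) : 0 <= N ->
  (forall x, cmod (f x) <= M) ->
  (forall x y, x <> y -> cmod (f x - f y) <= N * mdist x y `^ b) ->
  Lambda b f /\ Lambda_norm b f <= M + N.
Proof.
move=> N0 fM fN.
have ub1 : ubound (abs_values f) M by move=> _ [x _ <-].
have ub2 : ubound (holder_quotients b f) N.
  move=> _ [x [y [xy ->]]].
  by rewrite ler_pdivrMr ?powR_gt0 ?mdist_gt0 ?(introN eqP xy)// fN.
split; first by split; [exists M|exists N].
rewrite lerD//; first by apply: ge_sup => //; exact: abs_values_neq0.
have [->|/set0P ne] := eqVneq (holder_quotients b f) set0; first by rewrite sup0.
exact: ge_sup.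
Qed.

Lemma Lambda_one :
  Lambda b (fun _ : X => 1 : R[i]) /\ Lambda_norm b (fun _ : X => 1 : R[i]) <= 1.
Proof.
rewrite -[leRHS]addr0; apply: Lambda_norm_le => // [x|x y _]; first by rewrite cmod1.
by rewrite subrr cmod0 mul0r.
Qed.

Lemma Lambda_bounded_measurable f : 0 < b -> Lambda b f -> bounded_measurable f.
Proof.
move=> b0 /Lambda_normP[h1 h2]; split.
- apply: (@holder_measurable _ _ _ (Lambda_norm b f) b) => // y z.
  apply: le_trans (h2 y z); apply: le_trans (normr_Re_le _).
  by case: (f y); case: (f z).
- apply: (@holder_measurable _ _ _ (Lambda_norm b f) b) => // y z.
  apply: le_trans (h2 y z); apply: le_trans (normr_Im_le _).
  by case: (f y); case: (f z).
- by exists (Lambda_norm b f).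
Qed.

End LambdaNorm.

(** * The truncated operators *)

Section TruncatedOperator.
Context {R : realType} {X : pointedMetricType R}.
Variables (mu : {finite_measure set (borel X) -> \bar R}).
Variables (A n g b C1 C2 L C : R) (K : X -> X -> R[i]) (eta : R -> R).
Hypotheses (A0 : 0 < A) (n0 : 0 < n) (g0 : 0 < g) (g1 : g <= 1).
Hypotheses (b0 : 0 < b) (bn : b < n) (bg : b < g).
Hypotheses (C1_ge0 : 0 <= C1) (C2_ge0 : 0 <= C2) (L_ge0 : 0 <= L) (C_ge0 : 0 <= C).
Hypothesis growth : forall (x : X) (r : R), 0 < r ->
  (mu (ball x r) <= (A * r `^ n)%:E)%E.
Hypothesis K_size : forall x y, x <> y -> cmod (K x y) <= C1 * mdist x y `^ (- n).
Hypothesis K_smooth : forall x1 x2 y, x1 <> y -> x2 <> y ->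
  2 * mdist x1 x2 <= mdist x1 y ->
  cmod (K x1 y - K x2 y) <= C2 * (mdist x1 x2 `^ g * mdist x1 y `^ (- (n + g))).
Hypothesis K_meas : measurable_sections K.
Hypothesis eta01 : forall s, 0 <= s -> 0 <= eta s <= 1.
Hypothesis eta_eq0 : forall s, 0 <= s <= 2^-1 -> eta s = 0.
Hypothesis eta_eq1 : forall s, 1 <= s -> eta s = 1.
Hypothesis eta_lip : forall s t, 0 <= s -> 0 <= t ->
  `|eta s - eta t| <= L * `|s - t|.

Local Notation Ke := (truncated_kernel eta K).
Local Notation T := (T_trunc mu eta K).

Let Ke_meas e x : 0 < e -> bounded_measurable (Ke e x).
Proof. by move=> e0; exact: (bounded_measurable_truncated_kernel (L := L) (C1 := C1) (n := n)). Qed.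

Lemma T_truncE e f x : T e f x = cintegral mu (fun y => Ke e x y * f y).
Proof. by []. Qed.

Lemma T_trunc1 e x : T e (fun=> 1) x = cintegral mu (Ke e x).
Proof. by rewrite T_truncE; under eq_fun do rewrite mulr1. Qed.

Lemma T_trunc_linear e (a : R[i]) (f h : X -> R[i]) x : 0 < e ->
  bounded_measurable f -> bounded_measurable h ->
  T e (fun y => a * f y + h y) x = a * T e f x + T e h x.
Proof.
move=> e0 mf mh; rewrite !T_truncE.
have mKf := bounded_measurableM (Ke_meas x e0) mf.
have mKh := bounded_measurableM (Ke_meas x e0) mh.
have mc := bounded_measurable_cst (X := X) a.
rewrite -cintegralZ// -cintegralD//; last exact: bounded_measurableM.
by congr cintegral; apply/funext => y; ring.
Qed.

(** Subtracting the value of [f] at [x] makes the integrand a Hölder increment,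
    which cancels the singularity of the kernel; the price is a multiple of
    the image of the constant function 1. *)
Lemma T_trunc_sub_mean e f x : 0 < e -> bounded_measurable f ->
  T e f x - f x * T e (fun=> 1) x =
  cintegral mu (fun y => Ke e x y * (f y - f x)).
Proof.
move=> e0 mf; rewrite T_trunc1 T_truncE.
have mKf := bounded_measurableM (Ke_meas x e0) mf.
have mc := bounded_measurable_cst (X := X) (f x).
rewrite -cintegralZ//; last exact: Ke_meas.
rewrite -cintegralB//; last by apply: bounded_measurableM => //; exact: Ke_meas.
by congr cintegral; apply/funext => y; ring.
Qed.

Lemma near_part_le (x : X) (rho N : R) (F : X -> R[i]) : 0 < rho -> 0 <= N ->
  bounded_measurable F -> (forall y, rho <= mdist x y -> F y = 0) -> F x = 0 ->
  (forall y, x <> y -> cmod (F y) <= C1 * mdist x y `^ (- n) * (N * mdist x y `^ b)) ->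
  cmod (cintegral mu F) <= 2 * (C1 * N * (dyadic_const A n b * rho `^ b)).
Proof.
move=> rho0 N0 mF F0 Fx FN.
apply: (cintegral_dominated_le (D := [set y | 0 < mdist x y < rho])
  (g := fun y => mdist x y `^ (b - n))) => //.
- rewrite [X in measurable X](_ : _ = [set y | mdist x y \in `]0, rho[]).
    exact: measurable_mdist_preim.
  by apply/seteqP; split => y /=; rewrite in_itv.
- by apply: measurable_funTS; exact: measurable_mdist_powR.
- by rewrite mulr_ge0.
- move=> y /= /negP; rewrite negb_and -!leNgt => /orP[d0|]; last exact: F0.
  have -> : y = x by apply/esym/mdist_positivity/eqP; rewrite eq_le d0 mdist_ge0.
  exact: Fx.
- by move=> y _; rewrite powR_ge0.
- move=> y /= /andP[d0 _]; apply: le_trans (FN y _) _.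
    by apply/eqP; rewrite -mdist_gt0.
  rewrite addrC powRD ?(gt_eqF d0) ?implybT//.
  by rewrite le_eqVlt; apply/orP; left; apply/eqP; ring.
- exact: near_integral_le growth _ _ _ _ _ (ltW bn).
Qed.

Lemma far_part_le (x : X) (rho M : R) (F : X -> R[i]) : 0 < rho -> 0 <= M ->
  bounded_measurable F -> (forall y, mdist x y < rho -> F y = 0) ->
  (forall y, rho <= mdist x y -> cmod (F y) <= M * mdist x y `^ (- (n + (g - b)))) ->
  cmod (cintegral mu F) <= 2 * (M * (dyadic_const A n (g - b) * rho `^ (- (g - b)))).
Proof.
move=> rho0 M0 mF F0 FM.
apply: (cintegral_dominated_le (D := [set y | rho <= mdist x y])
  (g := fun y => mdist x y `^ (- (n + (g - b))))) => //.
- rewrite [X in measurable X](_ : _ = [set y | mdist x y \in `[rho, +oo[]).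
    exact: measurable_mdist_preim.
  by apply/seteqP; split => y /=; rewrite in_itv/= andbT.
- by apply: measurable_funTS; exact: measurable_mdist_powR.
- by move=> y /= /negP; rewrite -ltNge; exact: F0.
- by move=> y _; rewrite powR_ge0.
- by apply: far_integral_le => //; rewrite ?subr_gt0// ltW.
Qed.

Lemma bounded_part_le (D : set (borel X)) (M m : R) (F : X -> R[i]) :
  measurable D -> 0 <= M -> bounded_measurable F ->
  (forall y, ~ D y -> F y = 0) -> (forall y, cmod (F y) <= M) ->
  (mu D <= m%:E)%E -> cmod (cintegral mu F) <= 2 * (M * m).
Proof.
move=> mD M0 mF F0 FM muD.
apply: (cintegral_dominated_le (D := D) (g := cst 1)) => //.
- by move=> y _; rewrite mulr1.
- by rewrite [leLHS](integral_cst mu mD 1%:E) mul1e.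
Qed.

Let Ke_size e x y : 0 < e -> x <> y -> cmod (Ke e x y) <= C1 * mdist x y `^ (- n).
Proof. by move=> e0; exact: truncated_kernel_size. Qed.

Let Ke_bounded e t x y : 0 < t -> t <= e -> cmod (Ke e x y) <= C1 * (t / 2) `^ (- n).
Proof. exact: truncated_kernel_bounded. Qed.

Let Ke_diag e x : 0 < e -> Ke e x x = 0.
Proof. by move=> e0; rewrite truncated_kernel_eq0 ?mdistxx// ltW// divr_gt0. Qed.

Let indic_near (x : X) (rho : R) : X -> R[i] :=
  fun y => (\1_[set z | mdist x z < rho] y : R)%:C.

Lemma measurable_near (x : X) (rho : R) :
  measurable ([set z | mdist x z < rho] : set (borel X)).
Proof. by rewrite -ballEmdist; exact: measurable_borel_ball. Qed.

Lemma indic_near_meas x rho : bounded_measurable (indic_near x rho).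
Proof.
apply: (@bounded_measurable_real _ _ _ 1) => [|y].
  by apply: measurable_indic; exact: measurable_near.
by rewrite indicE; case: (_ \in _); rewrite ?normr1 ?normr0.
Qed.

Lemma indic_near1 x rho y : mdist x y < rho -> indic_near x rho y = 1.
Proof. by move=> d; rewrite /indic_near indicE mem_set. Qed.

Lemma indic_near0 x rho y : rho <= mdist x y -> indic_near x rho y = 0.
Proof. by move=> d; rewrite /indic_near indicE memNset//= ltNge d. Qed.

(** The three terms come from distances below 1, from distances at least 1, and
    from the image of the function 1. *)
Definition sup_const : R :=
  2 * (C1 * dyadic_const A n b) + 4 * (C1 * fine (mu [set: borel X])) + C.

Lemma T_trunc_sup_le e f N : 0 < e -> 0 <= N -> bounded_measurable f ->
  (forall x, cmod (f x) <= N) ->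
  (forall x y, cmod (f x - f y) <= N * mdist x y `^ b) ->
  (forall x, cmod (T e (fun=> 1) x) <= C) ->
  forall x, cmod (T e f x) <= sup_const * N.
Proof.
move=> e0 N0 mf fN fH T1 x.
have mk := Ke_meas x e0.
have mfx : bounded_measurable (fun y => f y - f x).
  by apply: bounded_measurableB => //; exact: bounded_measurable_cst.
have mchi := indic_near_meas x 1.
have mchi' : bounded_measurable (fun y => 1 - indic_near x 1 y).
  by apply: bounded_measurableB => //; exact: bounded_measurable_cst.
have mkf := bounded_measurableM mk mfx.
have mF1 := bounded_measurableM mchi mkf.
have mF2 := bounded_measurableM mchi' mkf.
have -> : T e f x = (T e f x - f x * T e (fun=> 1) x) + f x * T e (fun=> 1) x.
  by rewrite subrK.
rewrite T_trunc_sub_mean//.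
rewrite (_ : (fun y => _) = (fun y => indic_near x 1 y * (Ke e x y * (f y - f x)) +
    (1 - indic_near x 1 y) * (Ke e x y * (f y - f x)))); last first.
  by apply/funext => y; ring.
rewrite cintegralD//.
have h1 : cmod (cintegral mu (fun y => indic_near x 1 y * (Ke e x y * (f y - f x)))) <=
    2 * (C1 * N * (dyadic_const A n b * 1 `^ b)).
  apply: (near_part_le (x := x)) => //.
  - by move=> y d; rewrite indic_near0// mul0r.
  - by rewrite Ke_diag// mul0r mulr0.
  - move=> y xy; have [d|d] := leP 1 (mdist x y).
      by rewrite indic_near0// mul0r cmod0 !mulr_ge0 ?powR_ge0.
    by rewrite indic_near1// mul1r cmodM ler_pM ?cmod_ge0 ?Ke_size// cmodBC.
have h2 : cmod (cintegral mu (fun y =>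
    (1 - indic_near x 1 y) * (Ke e x y * (f y - f x)))) <=
    2 * (C1 * (2 * N) * fine (mu [set: borel X])).
  apply: (bounded_part_le (D := setT)) => //.
  - by rewrite !mulr_ge0.
  - by move=> y; case.
  - move=> y; have [d|d] := leP 1 (mdist x y); last first.
      by rewrite indic_near1// subrr mul0r cmod0 !mulr_ge0.
    rewrite indic_near0// subr0 mul1r cmodM ler_pM ?cmod_ge0//.
      apply: le_trans (Ke_size e0 _) _.
        by apply/eqP; rewrite -mdist_gt0; lra.
      rewrite ler_piMr//; have := powRN_le ltr01 d (ltW n0).
      by rewrite powR1.
    by apply: le_trans (cmodB_le _ _) _; have := fN x; have := fN y; lra.
  - by rewrite fineK// fin_num_measure.
have h3 : cmod (f x * T e (fun=> 1) x) <= N * C.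
  by rewrite cmodM ler_pM ?cmod_ge0.
apply: le_trans (cmodD_le _ _) _.
apply: le_trans (lerD (cmodD_le _ _) (lexx _)) _.
apply: le_trans (lerD (lerD h1 h2) h3) _.
rewrite powR1 /sup_const.
by rewrite le_eqVlt; apply/orP; left; apply/eqP; ring.
Qed.

Definition smooth_const : R := C2 + 2 * L * C1 * 2 `^ n.

(** The terms bound, in this order, the integrals of [W1], [W2], [W3] and [W4]
    in the proof of [T_trunc_holder_le] and the three multiples of images of the
    function 1. *)
Definition holder_const : R :=
  2 * (C1 * dyadic_const A n b * 3 `^ b) + 2 * (C1 * dyadic_const A n b * 4 `^ b) +
  2 * (smooth_const * dyadic_const A n (g - b)) + 2 * (C1 * A * 6 `^ n) + 3 * C.

Lemma holder_const_ge0 : 0 <= holder_const.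
Proof.
have := ltW (dyadic_const_gt0 n A0 b0).
have gb : 0 < g - b by rewrite subr_gt0.
have := ltW (dyadic_const_gt0 n A0 gb).
rewrite /holder_const /smooth_const.
move: (dyadic_const A n b) (dyadic_const A n (g - b)) => d1 d2 d2_ge0 d1_ge0.
by repeat first [done | exact: powR_ge0 | exact: ltW | apply: addr_ge0 | apply: mulr_ge0].
Qed.

(** With [r] the distance of the two points, the two integrals of increments of
    [f] are estimated separately within [3 * r] of [x1], where each is of order
    [r `^ b].  Beyond [3 * r] the smoothness of the kernel handles the common
    increment [f y - f x1], and there remains [f x2 - f x1] times the integral
    of the kernel at [x2] over the far region.  That integral is the image of 1
    under the operator truncated at scale [max e r], up to points at distance
    of order [r] where the kernel is at most of order [r `^ (- n)]; this is
    where the bound on the image of 1 is needed at every scale. *)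
Lemma T_trunc_holder_le e f N : 0 < e -> 0 <= N -> bounded_measurable f ->
  (forall x, cmod (f x) <= N) ->
  (forall x y, cmod (f x - f y) <= N * mdist x y `^ b) ->
  (forall e x, 0 < e -> cmod (T e (fun=> 1) x) <= C) ->
  (forall x y, cmod (T e (fun=> 1) x - T e (fun=> 1) y) <= C * mdist x y `^ b) ->
  forall x1 x2, x1 <> x2 ->
    cmod (T e f x1 - T e f x2) <= holder_const * N * mdist x1 x2 `^ b.
Proof.
move=> e0 N0 mf fN fH T1 T1H x1 x2 x12.
set r := mdist x1 x2.
have r0 : 0 < r by rewrite mdist_gt0; exact/eqP.
have r3 : 0 < 3 * r by rewrite mulr_gt0.
(* the scale at which the kernel at x2 imitates its restriction to the far region *)
pose e' := Num.max e r.
have e'0 : 0 < e' by rewrite lt_max e0.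
have d12 y : mdist x2 y <= mdist x1 y + r.
  by have := metric_triangle x2 x1 y; rewrite (metric_sym x2 x1) -/r addrC.
have d21 y : mdist x1 y <= mdist x2 y + r.
  by have := metric_triangle x1 x2 y; rewrite -/r addrC.
pose chi := indic_near x1 (3 * r).
pose k1 := Ke e x1; pose k2 := Ke e x2; pose k' := Ke e' x2.
have mchi : bounded_measurable chi by exact: indic_near_meas.
have mcst c := bounded_measurable_cst (X := X) c.
have mchi' : bounded_measurable (fun y => 1 - chi y) by exact: bounded_measurableB.
have mk1 : bounded_measurable k1 by exact: Ke_meas.
have mk2 : bounded_measurable k2 by exact: Ke_meas.
have mk' : bounded_measurable k' by exact: Ke_meas.
have mf1 : bounded_measurable (fun y => f y - f x1) by exact: bounded_measurableB.
have mf2 : bounded_measurable (fun y => f y - f x2) by exact: bounded_measurableB.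
pose W1 y := chi y * (k1 y * (f y - f x1)).
pose W2 y := chi y * (k2 y * (f y - f x2)).
pose W3 y := (1 - chi y) * ((k1 y - k2 y) * (f y - f x1)).
pose W4 y := (1 - chi y) * k2 y - k' y.
have mW1 : bounded_measurable W1 by do 2 apply: bounded_measurableM => //.
have mW2 : bounded_measurable W2 by do 2 apply: bounded_measurableM => //.
have mW3 : bounded_measurable W3.
  by do 2 apply: bounded_measurableM => //; exact: bounded_measurableB.
have mW4 : bounded_measurable W4.
  by apply: bounded_measurableB => //; exact: bounded_measurableM.
have decomp : T e f x1 - T e f x2 =
    cintegral mu W1 - cintegral mu W2 + cintegral mu W3 +
    (f x2 - f x1) * cintegral mu W4 + (f x2 - f x1) * T e' (fun=> 1) x2 +
    (f x1 * (T e (fun=> 1) x1 - T e (fun=> 1) x2) +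
     (f x1 - f x2) * T e (fun=> 1) x2).
  have split_int : cintegral mu (fun y => k1 y * (f y - f x1)) -
      cintegral mu (fun y => k2 y * (f y - f x2)) =
      cintegral mu W1 - cintegral mu W2 + cintegral mu W3 +
      (f x2 - f x1) * cintegral mu W4 + (f x2 - f x1) * cintegral mu k'.
    have mW12 := bounded_measurableB mW1 mW2.
    have mW123 := bounded_measurableD mW12 mW3.
    have mcW4 := bounded_measurableM (mcst (f x2 - f x1)) mW4.
    have mW1234 := bounded_measurableD mW123 mcW4.
    have mck' := bounded_measurableM (mcst (f x2 - f x1)) mk'.
    have mk1f := bounded_measurableM mk1 mf1.
    have mk2f := bounded_measurableM mk2 mf2.
    rewrite -(cintegralZ _ _ mW4) -(cintegralZ _ _ mk') -(cintegralB _ mW1 mW2).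
    rewrite -(cintegralD _ mW12 mW3) -(cintegralD _ mW123 mcW4).
    rewrite -(cintegralD _ mW1234 mck') -(cintegralB _ mk1f mk2f).
    congr cintegral; apply/funext => y; rewrite /W1 /W2 /W3 /W4; ring.
  rewrite T_trunc1 -/k' -split_int -!T_trunc_sub_mean//; ring.
have B1 : cmod (cintegral mu W1) <=
    2 * (C1 * N * (dyadic_const A n b * (3 * r) `^ b)).
  apply: (near_part_le (x := x1)) => //.
  - by move=> y d; rewrite /W1 /chi indic_near0// mul0r.
  - by rewrite /W1 /k1 Ke_diag// mul0r mulr0.
  - move=> y xy; have [d|d] := leP (3 * r) (mdist x1 y).
      by rewrite /W1 /chi indic_near0// mul0r cmod0 !mulr_ge0 ?powR_ge0.
    by rewrite /W1 /chi indic_near1// mul1r cmodM ler_pM ?cmod_ge0 ?Ke_size// cmodBC.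
(* the radius is 4 * r because the distance is now measured from x2 *)
have B2 : cmod (cintegral mu W2) <=
    2 * (C1 * N * (dyadic_const A n b * (4 * r) `^ b)).
  apply: (near_part_le (x := x2)) => //; first by rewrite mulr_gt0.
  - move=> y d; rewrite /W2 /chi indic_near0 ?mul0r//.
    by have := d12 y; lra.
  - by rewrite /W2 /k2 Ke_diag// mul0r mulr0.
  - move=> y xy; have [d|d] := leP (3 * r) (mdist x1 y).
      by rewrite /W2 /chi indic_near0// mul0r cmod0 !mulr_ge0 ?powR_ge0.
    by rewrite /W2 /chi indic_near1// mul1r cmodM ler_pM ?cmod_ge0 ?Ke_size// cmodBC.
have S0 : 0 <= smooth_const by rewrite addr_ge0// !mulr_ge0 ?powR_ge0.
have B3 : cmod (cintegral mu W3) <= 2 * (smooth_const * r `^ g * N *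
    (dyadic_const A n (g - b) * (3 * r) `^ (- (g - b)))).
  apply: (far_part_le (x := x1)) => //; first by rewrite !mulr_ge0 ?powR_ge0.
  - by move=> y d; rewrite /W3 /chi indic_near1// subrr mul0r.
  - move=> y d; have d0 : 0 < mdist x1 y by exact: lt_le_trans d.
    rewrite /W3 /chi indic_near0// subr0 mul1r cmodM.
    rewrite (_ : - (n + (g - b)) = - (n + g) + b); last by ring.
    rewrite powRD ?(gt_eqF d0) ?implybT//.
    rewrite (_ : _ * _ * N * _ = smooth_const * r `^ g * mdist x1 y `^ (- (n + g)) *
      (N * mdist x1 y `^ b)); last by ring.
    rewrite ler_pM ?cmod_ge0//; last by rewrite cmodBC.
    apply: truncated_kernel_smooth => //; last by rewrite -/r; lra.
    by apply/eqP; rewrite -mdist_gt0.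
have B4 : cmod (cintegral mu W4) <= 2 * (C1 * (r / 2) `^ (- n) * (A * (3 * r) `^ n)).
  (* both kernels equal K in the far region, unless they share the scale e *)
  have W40 y : 3 * r <= mdist x1 y -> W4 y = 0.
    move=> d; rewrite /W4 /chi indic_near0// subr0 mul1r.
    rewrite /k' /e' maxEle; case: (leP e r) => er; last by rewrite subrr.
    have d2 : 2 * r <= mdist x2 y by have := d21 y; lra.
    have h1 : e <= mdist x2 y by lra.
    have h2 : r <= mdist x2 y by lra.
    rewrite /k2 (truncated_kernelE K eta_eq1 e0 h1).
    by rewrite (truncated_kernelE K eta_eq1 r0 h2) subrr.
  apply: (bounded_part_le (measurable_near x1 (3 * r))) => //.
  - by rewrite mulr_ge0 ?powR_ge0.
  - by move=> y /= /negP; rewrite -leNgt; exact: W40.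
  - move=> y; have [d|d] := leP (3 * r) (mdist x1 y).
      by rewrite W40// cmod0 mulr_ge0 ?powR_ge0.
    rewrite /W4 /chi indic_near1// subrr mul0r sub0r cmodN.
    by apply: Ke_bounded => //; rewrite le_max lexx orbT.
  - by rewrite -ballEmdist; exact: growth.
have fd : cmod (f x1 - f x2) <= N * r `^ b by exact: fH.
have fd' : cmod (f x2 - f x1) <= N * r `^ b by rewrite cmodBC.
have B5 : cmod ((f x2 - f x1) * T e' (fun=> 1) x2) <= N * r `^ b * C.
  by rewrite cmodM ler_pM ?cmod_ge0 ?T1.
have B6 : cmod (f x1 * (T e (fun=> 1) x1 - T e (fun=> 1) x2)) <= N * (C * r `^ b).
  by rewrite cmodM ler_pM ?cmod_ge0.
have B7 : cmod ((f x1 - f x2) * T e (fun=> 1) x2) <= N * r `^ b * C.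
  by rewrite cmodM ler_pM ?cmod_ge0 ?T1.
have E3 : r `^ g * (3 * r) `^ (- (g - b)) <= r `^ b.
  apply: (@le_trans _ _ (r `^ g * r `^ (- (g - b)))).
    have r3r : r <= 3 * r by rewrite ler_peMl ?(ltW r0)// ler1n.
    have gb : 0 <= g - b by rewrite subr_ge0 ltW.
    by rewrite ler_wpM2l ?powR_ge0//; exact: powRN_le.
  rewrite -powRD ?(gt_eqF r0) ?implybT// (_ : g + _ = b)//; ring.
have E4 : (r / 2) `^ (- n) * (3 * r) `^ n = 6 `^ n.
  have r2 : 0 < r / 2 by rewrite divr_gt0.
  have -> : 3 * r = 6 * (r / 2) by field.
  rewrite (@powRM _ 6 (r / 2)) ?(ltW r2)// powRN mulrCA mulVf ?mulr1//.
  by rewrite gt_eqF// powR_gt0.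
have B3' : cmod (cintegral mu W3) <=
    2 * (smooth_const * dyadic_const A n (g - b)) * N * r `^ b.
  apply: le_trans B3 _.
  have : smooth_const * dyadic_const A n (g - b) * N *
      (r `^ g * (3 * r) `^ (- (g - b))) <=
      smooth_const * dyadic_const A n (g - b) * N * r `^ b.
    have dc0 : 0 <= dyadic_const A n (g - b).
      by apply: ltW; apply: dyadic_const_gt0 => //; rewrite subr_gt0.
    by apply: ler_wpM2l E3; exact: mulr_ge0 (mulr_ge0 S0 dc0) N0.
  lra.
have B4' : cmod ((f x2 - f x1) * cintegral mu W4) <=
    N * r `^ b * (2 * (C1 * A * 6 `^ n)).
  rewrite cmodM ler_pM ?cmod_ge0//; apply: le_trans B4 _.
  by rewrite -E4 le_eqVlt; apply/orP; left; apply/eqP; ring.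
rewrite decomp.
apply: (@le_trans _ _ (cmod (cintegral mu W1) + cmod (cintegral mu W2) +
   cmod (cintegral mu W3) + cmod ((f x2 - f x1) * cintegral mu W4) +
   cmod ((f x2 - f x1) * T e' (fun=> 1) x2) +
   (cmod (f x1 * (T e (fun=> 1) x1 - T e (fun=> 1) x2)) +
    cmod ((f x1 - f x2) * T e (fun=> 1) x2)))).
  do 3 apply: le_trans (cmodD_le _ _) (lerD _ _) => //.
  apply: le_trans (cmodD_le _ _) (lerD _ _) => //.
  exact: cmodB_le.
rewrite !powRM ?(ltW r0)// in B1 B2.
rewrite /holder_const.
have -> : (2 * (C1 * dyadic_const A n b * 3 `^ b) + 2 * (C1 * dyadic_const A n b * 4 `^ b) +
  2 * (smooth_const * dyadic_const A n (g - b)) + 2 * (C1 * A * 6 `^ n) + 3 * C) * N * r `^ b =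
  2 * (C1 * N * (dyadic_const A n b * (3 `^ b * r `^ b))) +
  2 * (C1 * N * (dyadic_const A n b * (4 `^ b * r `^ b))) +
  2 * (smooth_const * dyadic_const A n (g - b)) * N * r `^ b +
  N * r `^ b * (2 * (C1 * A * 6 `^ n)) + N * r `^ b * C +
  (N * (C * r `^ b) + N * r `^ b * C) by ring.
by do 4 apply: lerD => //; apply: lerD.
Qed.

End TruncatedOperator.

(** * Equivalence of the two uniform bounds *)

Theorem theorem2 (R : realType) (X : pointedMetricType R)
    (mu : {finite_measure set (borel X) -> \bar R})
    (n gamma beta : R) (K : X -> X -> R[i]) (eta : R -> R)
    (n_gt0 : 0 < n)
    (mu_growth : growth_condition mu n)
    (mu_supp : is_support mu [set: X])
    (K_standard : standard_kernel n gamma K)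
    (K_meas : measurable_sections K)
    (beta_range : 0 < beta < Num.min n gamma)
    (eta_cutoff : cutoff eta) :
  (exists C : R, forall e : R, 0 < e ->
     Lambda beta (T_trunc mu eta K e (fun=> 1)) /\
     Lambda_norm beta (T_trunc mu eta K e (fun=> 1)) <= C)
  <->
  ((forall e : R, 0 < e -> Lambda_bounded beta (T_trunc mu eta K e)) /\
   exists C' : R, forall e : R, 0 < e ->
     Lambda_opnorm beta (T_trunc mu eta K e) <= C').
Proof.
move: beta_range; rewrite lt_min => /and3P[b0 bn bg].
have [Lambda1 norm1] := @Lambda_one _ X beta.
split; last first.
  move=> [Tbdd [C' TC']]; exists C' => e e0.
  have [TL _ [M TM]] := Tbdd e e0.
  split; first exact: TL.
  apply: le_trans (TC' e e0); apply: ub_le_sup; last by exists (fun=> 1).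
  exists `|M| => _ [f [Lf f1] <-]; apply: le_trans (TM f Lf) _.
  have f0 := Lambda_norm_ge0 Lf.
  apply: le_trans (ler_wpM2r f0 (ler_norm M)) _.
  by rewrite ler_piMr.
move=> [C TC].
have [A A0 growth] := mu_growth.
have [/andP[g0 g1] [C1 KC1] [C2 KC2]] := K_standard.
have [L L0 eta_lip] := cutoff_lipschitz eta_cutoff.
have [_ eta01 eta_eq0 eta_eq1] := eta_cutoff.
have C0 : 0 <= C.
  by have [LT TC1] := TC 1 ltr01; exact: le_trans (Lambda_norm_ge0 LT) TC1.
have K_size x y : x <> y -> cmod (K x y) <= `|C1| * mdist x y `^ (- n).
  move=> xy; apply: le_trans (KC1 x y xy) _.
  by rewrite powRN ler_wpM2r ?invr_ge0 ?powR_ge0// ler_norm.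
have K_smooth x1 x2 y : x1 <> y -> x2 <> y -> 2 * mdist x1 x2 <= mdist x1 y ->
    cmod (K x1 y - K x2 y) <=
    `|C2| * (mdist x1 x2 `^ gamma * mdist x1 y `^ (- (n + gamma))).
  move=> x1y x2y d; apply: le_trans (KC2 x1 x2 y x1y x2y d) _.
  by rewrite powRN ler_wpM2r ?mulr_ge0 ?invr_ge0 ?powR_ge0// ler_norm.
have T1 e x : 0 < e -> cmod (T_trunc mu eta K e (fun=> 1) x) <= C.
  by move=> e0; have [LT TC1] := TC e e0; apply: le_trans TC1; apply (Lambda_normP LT).1.
have T1H e x y : 0 < e -> cmod (T_trunc mu eta K e (fun=> 1) x -
    T_trunc mu eta K e (fun=> 1) y) <= C * mdist x y `^ beta.
  move=> e0; have [LT TC1] := TC e e0.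
  apply: le_trans ((Lambda_normP LT).2 x y) _.
  by rewrite ler_wpM2r ?powR_ge0.
pose S := sup_const mu A n beta `|C1| C.
pose H := holder_const A n gamma beta `|C1| `|C2| L C.
have H0 : 0 <= H.
  by apply: holder_const_ge0 => //; exact: ltW.
have key e f : 0 < e -> Lambda beta f ->
    Lambda beta (T_trunc mu eta K e f) /\
    Lambda_norm beta (T_trunc mu eta K e f) <= (S + H) * Lambda_norm beta f.
  move=> e0 Lf; have N0 := Lambda_norm_ge0 Lf.
  have [fN fH] := Lambda_normP Lf; have mf := Lambda_bounded_measurable b0 Lf.
  rewrite mulrDl; apply: Lambda_norm_le => //; first exact: mulr_ge0.
  - move=> x; apply: (T_trunc_sup_le (L := L)) => //.
    by move=> z; exact: T1.
  - move=> x y xy; apply: (T_trunc_holder_le (g := gamma)) => //.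
    by move=> z w; exact: T1H.
split.
  move=> e e0; split.
  - by move=> f Lf; have [] := key e f e0 Lf.
  - move=> a f h Lf Lh x.
    apply: (T_trunc_linear mu n_gt0 (normr_ge0 C1) L0 K_size K_meas
      eta01 eta_eq0 eta_lip) => //; exact: Lambda_bounded_measurable b0 _.
  - by exists (S + H) => f Lf; have [] := key e f e0 Lf.
exists `|S + H| => e e0; apply: ge_sup.
  by exists (Lambda_norm beta (T_trunc mu eta K e (fun=> 1))), (fun=> 1).
move=> _ [f [Lf f1] <-]; have [_ h] := key e f e0 Lf.
apply: le_trans h _; have N0 := Lambda_norm_ge0 Lf.
apply: le_trans (ler_wpM2r N0 (ler_norm _)) _.
by rewrite ler_piMr.
Qed.
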